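(* Let $G$ be a graph with node-set $[n]$ and strong blocks $G_e$ on $p_e$ nodes, $e\in E$. Let $\mathcal{G}=\{\mathcal{G}_e=(a_e,D^*_{G_e}):e\in E\}$ be an additive-multiplicative block-datum over the commutative unital ring $R$, with corresponding matrices $D_{\mathcal{G}}, D^*_G, D_{\mathcal{G}_e}, D^*_{G_e}$. Let $v_0$ be any vertex of $G$ (not necessarily a cut-vertex). Then $\kappa(D_{\mathcal{G}},v_0)$ is independent of $v_0$ and equals $$\kappa(D_{\mathcal{G}},v_0)=\det(D^*_G)\prod_{e\in E}a_e^{p_e-1}.$$ Write this common value as $\kappa(D_{\mathcal{G}})$, so that $\kappa(D_{\mathcal{G}_e})=a_e^{p_e-1}\det(D^*_{G_e})$. Then the following identities hold: $$\kappa(D_{\mathcal{G}})=\prod_{e\in E}\kappa(D_{\mathcal{G}_e}),$$ $$\frac{\det(D_{\mathcal{G}})}{\kappa(D_{\mathcal{G}})}=\sum_{e\in E}\frac{\det(D_{\mathcal{G}_e})}{\kappa(D_{\mathcal{G}_e})},$$ $$\frac{\operatorname{cof}(D_{\mathcal{G}})}{\kappa(D_{\mathcal{G}})}-1=\sum_{e\in E}\left(\frac{\operatorname{cof}(D_{\mathcal{G}_e})}{\kappa(D_{\mathcal{G}_e})}-1\right),$$ where the denominators in the second and third formulas are placeholders, to be cancelled by multiplying both sides by $\kappa(D_{\mathcal{G}})=\prod_{e}\kappa(D_{\mathcal{G}_e})$; that is, they mean $\det(D_{\mathcal{G}})=\sum_{e}\det(D_{\mathcal{G}_e})\prod_{f\ne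 e}\kappa(D_{\mathcal{G}_f})$ and $\operatorname{cof}(D_{\mathcal{G}})=\prod_e\kappa(D_{\mathcal{G}_e})+\sum_{e}\big(\operatorname{cof}(D_{\mathcal{G}_e})-\kappa(D_{\mathcal{G}_e})\big)\prod_{f\neq e}\kappa(D_{\mathcal{G}_f})$. Finally, $$\operatorname{cof}(D_{\mathcal{G}})=\operatorname{cof}(D^*_G)\prod_{e\in E}a_e^{p_e-1},\qquad \frac{\operatorname{cof}(D_{\mathcal{G}})}{\kappa(D_{\mathcal{G}})}=\frac{\operatorname{cof}(D^*_G)}{\det(D^*_G)},$$ where the last identity is again read after clearing denominators, i.e. $\operatorname{cof}(D_{\mathcal{G}})\det(D^*_G)=\kappa(D_{\mathcal{G}})\operatorname{cof}(D^*_G)$.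
   Context: Graphs are finite, simple, directed and strongly connected (there are directed paths between any two distinct vertices). A cut-vertex is a vertex whose removal disconnects the underlying undirected graph; the strong blocks of $G$ are its maximal (connected) subgraphs without cut-vertices of their own. $E$ indexes the strong blocks $G_e$ of $G$; $V(G_e)$ is the vertex set of $G_e$ and $p_e=|V(G_e)|$. $R$ is an arbitrary commutative unital ring. $\mathbf{e}$ denotes an all-ones column vector and $J=\mathbf{e}\mathbf{e}^T$ an all-ones square matrix, of the dimension dictated by context. For a square matrix $A$ over $R$, $\operatorname{cof}(A):=\mathbf{e}^T\mathrm{adj}(A)\mathbf{e}$ is the sum of all cofactors of $A$. Additive-multiplicative block-datum: a family $\mathcal{G}=\{\mathcal{G}_e=(a_e,D^*_{G_e}):e\in E\}$ with $a_e\in R$ and $D^*_{G_e}\in R^{p_e\times p_e}$ a matrix (rows and columns indexed by $V(G_e)$) with all diagonal entries equal to $1$ (otherwise arbitrary). Multiplicative distance matrix $D^*_G=(m_{ij})_{i,j\in V(G)}$: its principal submatrix on $V(G_e)$ is $D^*_{G_e}$, and for $i,j$ not in a common block, inductively $m_{ij}:=m_{iv}m_{vj}$ where $v\neq i,j$ is any cut-vertex separating $i$ from $j$ (independent of the choice of $v$). Additive-multiplicative distance matrix $D_{\mathcal{G}}=(d_{ij})_{i,j\in V(G)}$: its principal submatrix on $V(G_e)$ is $D_{\mathcal{G}_e}:=a_e(D^*_{G_e}-J)$, and for $i,j$ not in a common block, inductively $d_{ij}:=d_{iv}+m_{iv}d_{vj}$ where $v\neq i,j$ is any cut-vertex separating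 $i$ from $j$ (independent of the choice of $v$). Invariant $\kappa$: for a vertex $v_0$ of $G$ with vertex set $V$, order the vertices with $v_0$ last and write $D_{\mathcal{G}}=\begin{pmatrix}D_1&\mathbf{u}_1\\ \mathbf{w}_1^T&0\end{pmatrix}$, where $D_1$ is the principal submatrix on $V\setminus\{v_0\}$; let $\mathbf{m}=(m_{v v_0})_{v\in V\setminus\{v_0\}}$ (column vector). Then $\kappa(D_{\mathcal{G}},v_0):=\det\left(D_1-\mathbf{u}_1\mathbf{e}^T-\mathbf{m}\,\mathbf{w}_1^T\right)$. The same definition applied to the one-block graph $G_e$ with datum $(a_e,D^*_{G_e})$ gives $\kappa(D_{\mathcal{G}_e},v_0)$ for $v_0\in V(G_e)$. *)

(* Defs.v *)
From mathcomp Require Import all_boot all_algebra.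

Set Implicit Arguments.
Unset Strict Implicit.
Unset Printing Implicit Defensive.

Import GRing.Theory.
Local Open Scope ring_scope.

Section Graphs.

Variable T : finType.

(* A (sub)graph is a pair (vertices, arcs); it need not be induced. *)
Definition sgraph : Type := ({set T} * {set T * T})%type.

Implicit Types (H K : sgraph) (v i j : T).

Definition verts H : {set T} := H.1.
Definition arcs H : {set T * T} := H.2.

Definition whole_graph (g : rel T) : sgraph :=
  ([set: T], [set p : T * T | g p.1 p.2]).

Definition well_formed H : bool :=
  [forall p in arcs H, (p.1 \in verts H) && (p.2 \in verts H)].

Definition subgraph H K : bool :=
  (verts H \subset verts K) && (arcs H \subset arcs K).

Definition uadj H : rel T :=
  [rel i j | ((i, j) \in arcs H) || ((j, i) \in arcs H)].

(* Connectedness of the underlying undirected graph. *)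
Definition uconnected H : bool :=
  [forall i in verts H, forall j in verts H, connect (uadj H) i j].

Definition remove_vertex H v : sgraph :=
  (verts H :\ v, [set p in arcs H | (p.1 != v) && (p.2 != v)]).

(* Used for connected H only, where it says that removing v disconnects H. *)
Definition cut_vertex H v : bool :=
  (v \in verts H) && ~~ uconnected (remove_vertex H v).

Definition nonseparable H : bool :=
  uconnected H && [forall v, ~~ cut_vertex H v].

Variable g : rel T.

Definition is_block H : bool :=
  [&& well_formed H, subgraph H (whole_graph g), nonseparable H
    & [forall K : sgraph,
        [&& well_formed K, subgraph K (whole_graph g), nonseparable K
          & subgraph H K] ==> (K == H)]].

Definition block : Type := {H : sgraph | is_block H}.

Definition bverts (e : block) : {set T} := verts (val e).

Definition bsize (e : block) : nat := #|bverts e|.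

Definition separates v i j : bool :=
  [&& v != i, v != j, cut_vertex (whole_graph g) v
    & ~~ connect (uadj (remove_vertex (whole_graph g) v)) i j].

End Graphs.

Section Distances.

Variables (R : comPzRingType) (n : nat) (g : rel 'I_n).

(* Matrices indexed by the vertices of a block e have type 'M_(bsize e); the
   row (or column) i : 'I_(bsize e) is the one of the vertex enum_val i.
   block_entry reads the entry at a pair of vertices of e. *)
Definition block_entry (e : block g) (A : 'M[R]_(bsize e)) (x y : 'I_n) : R :=
  \sum_(i < bsize e | enum_val i == x) \sum_(j < bsize e | enum_val j == y)
    A i j.

(* The common inductive scheme: on a common block take the entry of the block
   matrix, otherwise combine the values at (i, v) and (v, j) for a cut-vertex v
   separating i from j.  Both values have strictly fewer separating
   cut-vertices than (i, j), which itself has fewer than n, so that with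
   fuel k = n the two default values 0 are never reached. *)
Fixpoint glue (B : forall e : block g, 'M[R]_(bsize e))
    (op : 'I_n -> 'I_n -> R -> R -> R) (k : nat) (i j : 'I_n) : R :=
  if [pick e : block g | (i \in bverts e) && (j \in bverts e)] is Some e then
    block_entry (B e) i j
  else if k is k'.+1 then
    if [pick v | separates g v i j] is Some v then
      op i v (glue B op k' i v) (glue B op k' v j)
    else 0
  else 0.

Variables (a : block g -> R) (Dst : forall e : block g, 'M[R]_(bsize e)).

Definition mult_dist : 'M[R]_n :=
  \matrix_(i, j) glue Dst (fun _ _ miv mvj => miv * mvj) n i j.

Definition block_add_dist (e : block g) : 'M[R]_(bsize e) :=
  a e *: (Dst e - const_mx 1).

Definition add_dist : 'M[R]_n :=
  \matrix_(i, j)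
    glue block_add_dist (fun i v div dvj => div + mult_dist i v * dvj) n i j.

End Distances.

Definition cof (R : comPzRingType) (p : nat) (A : 'M[R]_p) : R :=
  ((const_mx 1 : 'rV[R]_p) *m \adj A *m (const_mx 1 : 'cV[R]_p)) 0 0.

(* D is the additive-multiplicative and M the multiplicative distance matrix.
   Deleting row and column v0, instead of moving them to the last position,
   does not affect the determinant. *)
Definition kappa (R : comPzRingType) (p : nat) (D M : 'M[R]_p) (v0 : 'I_p) : R :=
  let D1 : 'M_p.-1 := row' v0 (col' v0 D) in
  let u1 : 'cV_p.-1 := row' v0 (col v0 D) in
  let w1T : 'rV_p.-1 := col' v0 (row v0 D) in
  let m : 'cV_p.-1 := row' v0 (col v0 M) in
  \det (D1 - u1 *m (const_mx 1 : 'rV_p.-1) - m *m w1T).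

(* Main.v *)
(* Idea.  Fix a vertex v0 and put N_ij = d_ij - d_iv0 - m_iv0 d_v0j, so that
   kappa(v0) is the determinant of N with row and column v0 removed.  If v
   separates i from j, the gluing laws say exactly that N_ij = 0 for v0 = v.
   Hence when the vertex set is A U B with A and B meeting in a cut-vertex v,
   subtracting m_iv times row v from row i, and column v from the other columns,
   makes D + yJ block diagonal up to the border formed by row and column v.  So
   kappa is multiplicative, and
     det_{AUB}(D+yJ) = det_A(D+yJ) kappa_B + kappa_A det_B(D+yJ)
                       - y kappa_A kappa_B.
   As det(D+yJ) = det D + y cof D, this contains the laws for det and cof.
   One splits vertex sets at cut-vertices until single blocks remain; there
   N = a (m_ij - m_iv0 m_v0j) is a times the Schur complement of m_v0v0 = 1.
   The formulas for det M and cof M are those of D for the datum with all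
   a_e = 1, since M = J + (M - J). *)
Require Import Defs.
From mathcomp Require Import all_boot all_algebra ring.
Import GRing.Theory.
Local Open Scope ring_scope.

Set Implicit Arguments.
Unset Strict Implicit.
Unset Printing Implicit Defensive.

(** * Principal minors *)

(** Sylvester's identity. The matrix [block_mx 1%:M (- A) B 1%:M] is made block triangular in two
    ways, each by a factor of determinant 1; the two Schur complements that remain are the two
    sides. *)
Lemma det_1D_mulmxC (R : comPzRingType) (m n : nat)
    (A : 'M[R]_(m, n)) (B : 'M[R]_(n, m)) :
  \det (1%:M + A *m B) = \det (1%:M + B *m A).
Proof.
have e1 : block_mx (1%:M + A *m B) 0 B 1%:M
    = block_mx 1%:M A 0 1%:M *m block_mx 1%:M (- A) B 1%:M.
  by rewrite mulmx_block !mul1mx !mulmx1 !mul0mx addNr !add0r.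
have e2 : block_mx 1%:M (- A) B 1%:M
    = block_mx 1%:M 0 B 1%:M *m block_mx 1%:M (- A) 0 (1%:M + B *m A).
  rewrite mulmx_block !mul1mx !mulmx1 !mul0mx !addr0 mulmxN.
  by rewrite addrCA addNr addr0.
have := congr1 determinant e1.
by rewrite e2 !det_mulmx !det_lblock !det_ublock !det1 !(mul1r, mulr1).
Qed.

Lemma det_1D_col_row (R : comPzRingType) (n : nat) (u : 'cV[R]_n) (w : 'rV[R]_n) :
  \det (1%:M + u *m w) = 1 + (w *m u) 0 0.
Proof. by rewrite det_1D_mulmxC det_mx11 !mxE eqxx. Qed.

Section PrincipalMinors.

Variables (R : comPzRingType) (n : nat).
Implicit Types (U W : {set 'I_n}) (X Y : 'I_n -> 'I_n -> R).

Definition pad U X : 'M[R]_n :=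
  \matrix_(i, j) if (i \in U) && (j \in U) then X i j else (i == j)%:R.

(* Padding by the identity keeps the size n, whatever the set U. *)
Definition pminor U X : R := \det (pad U X).

Let proj U : 'M[R]_n := diag_mx (\row_i (i \in U)%:R).

(** The shape 1 + P Z P, with P the coordinate projection on [U], gives [det_1D_mulmxC] access to
    padded matrices. *)
Let padE U X :
  pad U X = 1%:M + proj U *m (\matrix_(i, j) X i j - 1%:M) *m proj U.
Proof.
apply/matrixP => i j; rewrite mul_mx_diag mul_diag_mx !mxE.
case: (i \in U); case: (j \in U) => /=; rewrite ?(mul0r, mul1r, mulr0, mulr1, addr0) //.
by rewrite addrC subrK.
Qed.

Lemma eq_pminor U X Y :
  (forall i j, i \in U -> j \in U -> X i j = Y i j) -> pminor U X = pminor U Y.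
Proof.
move=> eXY; congr (\det _); apply/matrixP => i j; rewrite !mxE.
by case: ifP => // /andP[iU jU]; apply: eXY.
Qed.

Lemma pminor_tr U X : pminor U (fun i j => X j i) = pminor U X.
Proof.
rewrite /pminor -det_tr; congr (\det _); apply/matrixP => i j; rewrite !mxE.
by rewrite andbC eq_sym.
Qed.

(** The 0/1 matrix E of [f] satisfies E E^T = 1, while E^T E is the projection on [U]. Sylvester's
    identity then exchanges 1 + E^T (E Z E^T) E of size [n] for 1 + E Z E^T of size [k]. *)
Lemma det_mxsub_pminor k (f : 'I_k -> 'I_n) U X :
  injective f -> (forall x, (x \in U) = (x \in codom f)) ->
  \det (\matrix_(i, j) X (f i) (f j)) = pminor U X.
Proof.
move=> f_inj fU.
pose E : 'M[R]_(k, n) := \matrix_(i, x) (f i == x)%:R.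
have EEt : E *m E^T = 1%:M.
  apply/matrixP => i j; rewrite !mxE (bigD1 (f i)) //= !mxE eqxx mul1r.
  rewrite big1 ?addr0; first by rewrite eq_sym (inj_eq f_inj).
  by move=> x ne; rewrite !mxE eq_sym (negPf ne) mul0r.
have EtE : E^T *m E = proj U.
  apply/matrixP => x y; rewrite !mxE fU.
  case: (boolP (x \in codom f)) => [/codomP[i ->]|xf].
    rewrite (bigD1 i) //= !mxE eqxx mul1r big1 ?addr0; last first.
      by move=> j ne; rewrite !mxE (inj_eq f_inj) (negPf ne) mul0r.
    by case: eqP => // ->.
  rewrite big1 ?mul0rn // => j _; rewrite !mxE.
  by case: eqP => [e|_]; rewrite ?mul0r //; rewrite -e codom_f in xf.
have EZEt (Z : 'M[R]_n) : E *m Z *m E^T = \matrix_(i, j) Z (f i) (f j).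
  apply/matrixP => i j; rewrite !mxE (bigD1 (f j)) //= !mxE eqxx mulr1.
  rewrite [X in _ + X]big1 ?addr0 => [|x ne]; last first.
    by rewrite [E^T _ _]mxE [E _ x]mxE eq_sym (negPf ne) mulr0.
  rewrite (bigD1 (f i)) //= !mxE eqxx mul1r big1 ?addr0 // => x ne.
  by rewrite !mxE eq_sym (negPf ne) mul0r.
rewrite /pminor padE -EtE -!mulmxA det_1D_mulmxC !mulmxA -(mulmxA _ E) EEt mulmx1.
rewrite EZEt; congr (\det _).
apply/matrixP => i j; rewrite !mxE (inj_eq f_inj).
by rewrite addrC subrK.
Qed.

(** Block triangularity without reordering the indices. For the projections P, Q on [U], [W] and Y =
    X - 1 one has PQ = 0 and PYQ = 0, so the padded matrix factors as (1 + PYP)(1 + QYP)(1 + QYQ).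
    The middle factor has determinant 1 by Sylvester's identity. *)
Lemma pminorU U W X :
  [disjoint U & W] -> (forall i j, i \in U -> j \in W -> X i j = 0) ->
  pminor (U :|: W) X = pminor U X * pminor W X.
Proof.
move=> dUW X0; rewrite /pminor !padE.
set Y := _ - _; set P := proj U; set Q := proj W.
have UW i : i \in U -> i \in W = false by move=> iU; apply: (disjointFr dUW).
have PQ0 : P *m Q = 0.
  apply/matrixP => i j; rewrite mul_diag_mx !mxE.
  by case: (boolP (i \in U)) => [/UW->|_]; rewrite ?mul0rn ?mulr0 ?mul0r.
have PYQ0 : P *m Y *m Q = 0.
  apply/matrixP => i j; rewrite mul_mx_diag mul_diag_mx !mxE.
  case: (boolP (i \in U)) => [iU|_]; last by rewrite !mul0r.
  case: (boolP (j \in W)) => [jW|_]; last by rewrite !mulr0.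
  rewrite X0 //; case: eqP => [eij|_]; last by rewrite subr0 mulr0 mul0r.
  by rewrite -eij UW in jW.
have -> : proj (U :|: W) = P + Q.
  apply/matrixP => i j; rewrite !mxE inE -mulrnDl.
  by case: (boolP (i \in U)) => [/UW->|_]; rewrite ?addr0 ?add0r.
have -> : 1%:M + (P + Q) *m Y *m (P + Q) =
    (1%:M + P *m Y *m P) *m ((1%:M + Q *m Y *m P) *m (1%:M + Q *m Y *m Q)).
  have PYPQ0 Z : P *m Y *m P *m (Q *m Z) = 0.
    by rewrite mulmxA -(mulmxA _ P) PQ0 mulmx0 mul0mx.
  have QYPQ0 Z : Q *m Y *m P *m (Q *m Z) = 0.
    by rewrite mulmxA -(mulmxA _ P) PQ0 mulmx0 mul0mx.
  have ab : P *m Y *m P *m (Q *m Y *m P) = 0 by rewrite -(mulmxA Q) PYPQ0.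
  have ac : P *m Y *m P *m (Q *m Y *m Q) = 0 by rewrite -(mulmxA Q) PYPQ0.
  have bc : Q *m Y *m P *m (Q *m Y *m Q) = 0 by rewrite -(mulmxA Q Y Q) QYPQ0.
  have -> : 1%:M + (P + Q) *m Y *m (P + Q) = 1%:M + (P *m Y *m P + Q *m Y *m P + Q *m Y *m Q).
    by rewrite mulmxDr !mulmxDl PYQ0 add0r.
  move: ab ac bc; set a := P *m Y *m P; set b := Q *m Y *m P.
  set c := Q *m Y *m Q => ab ac bc.
  rewrite !(mulmxDl, mulmxDr, mul1mx, mulmx1) bc mulmx0 ab ac !addr0.
  by rewrite -!addrA; congr (_ + _); rewrite !addrA addrC addrA addrAC.
by rewrite !det_mulmx (det_1D_mulmxC (Q *m Y) P) mulmxA PQ0 mul0mx addr0 det1 mul1r.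
Qed.

(** Left multiplication by 1 + u e_v^T has determinant 1 + u_v, which is 1 because [c v = 0]. The
    vector u vanishes outside [U], so the padding rows stay intact. *)
Lemma pminor_row_op U (v : 'I_n) (c : 'I_n -> R) X :
  v \in U -> c v = 0 ->
  pminor U (fun i j => X i j - c i * X v j) = pminor U X.
Proof.
move=> vU cv0.
pose u : 'cV[R]_n := \col_i (if i \in U then - c i else 0).
have -> : pminor U X = \det ((1%:M + u *m delta_mx 0 v) *m pad U X).
  rewrite det_mulmx det_1D_col_row -rowE !mxE vU cv0 oppr0 addr0 mul1r //.
congr (\det _); rewrite mulmxDl mul1mx -mulmxA -rowE.
apply/matrixP => i j; rewrite !mxE big_ord1 !mxE vU.
case: (boolP (i \in U)) => /= iU; last by rewrite mul0r addr0.
case: ifP => jU; first by rewrite mulNr.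
have ne k : k \in U -> (k == j) = false.
  by move=> kU; apply/eqP => e; rewrite e jU in kU.
by rewrite !ne // mulr0 addr0.
Qed.

Lemma pminor_col_op U (v : 'I_n) (c : 'I_n -> R) X :
  v \in U -> c v = 0 ->
  pminor U (fun i j => X i j - c j * X i v) = pminor U X.
Proof.
move=> vU cv0; rewrite -pminor_tr.
by rewrite (pminor_row_op (fun i j => X j i) vU cv0) pminor_tr.
Qed.

Lemma pminor_rowD U (v : 'I_n) X (b c : 'I_n -> R) :
  v \in U ->
  pminor U (fun i j => if i == v then b j + c j else X i j) =
  pminor U (fun i j => if i == v then b j else X i j) +
  pminor U (fun i j => if i == v then (if j \in U then c j else 0) else X i j).
Proof.
move=> vU.
rewrite -[pminor U (fun i j => if _ then b j else _)]mul1r.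
rewrite -[X in _ + X]mul1r /pminor.
have H (w : 'I_n -> R) i j : i != v ->
  pad U (fun i j => if i == v then w j else X i j) i j = pad U X i j.
  by move=> ne; rewrite !mxE (negPf ne).
apply: (determinant_multilinear (i0 := v)).
- apply/rowP => j; rewrite !mxE vU eqxx /= !mul1r.
  case: (boolP (j \in U)) => jU //=.
  by case: eqP => [e|_]; rewrite ?addr0 // -e vU in jU *.
- by apply/matrixP => i j; rewrite !mxE !(eq_sym _ v) (negPf (neq_lift _ _)).
- by apply/matrixP => i j; rewrite !mxE !(eq_sym _ v) (negPf (neq_lift _ _)).
Qed.

(** The padding does not scale with [a], so the minor is first rewritten as a determinant of size
    [#|U|]. *)
Lemma pminorZ U a X : pminor U (fun i j => a * X i j) = a ^+ #|U| * pminor U X.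
Proof.
have cU x : (x \in U) = (x \in codom (enum_val (A := mem U))).
  apply/idP/codomP => [xU|[i ->]]; last exact: enum_valP.
  by exists (enum_rank_in xU x); rewrite enum_rankK_in.
rewrite -!(det_mxsub_pminor _ (@enum_val_inj _ _) cU) -detZ.
by congr (\det _); apply/matrixP => i j; rewrite !mxE.
Qed.

Lemma pminor1 (v : 'I_n) X : pminor [set v] X = X v v.
Proof.
rewrite -(det_mxsub_pminor (f := fun _ : 'I_1 => v)).
- by rewrite det_mx11 mxE.
- by move=> i j _; rewrite !ord1.
- move=> x; rewrite inE; apply/eqP/codomP => [->|[]//]; by exists ord0.
Qed.

End PrincipalMinors.

(** * Rank-one updates and cofactor sums *)

(** The rank-one term is added one row at a time: [part s] has received it in the rows of [s]. By
    multilinearity a new row i contributes [u i 0] times a determinant whose row i is [w]; this row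
    clears the multiples of [w] already added elsewhere, and expansion along it gives an entry of
    [w *m \adj A]. *)
Lemma det_addrank1 (R : comPzRingType) (n : nat) (A : 'M[R]_n) (u : 'cV[R]_n)
    (w : 'rV[R]_n) :
  \det (A + u *m w) = \det A + (w *m \adj A *m u) 0 0.
Proof.
pose setrow (X : 'M[R]_n) (i : 'I_n) : 'M[R]_n := \matrix_(k, j) if k == i then w 0 j else X k j.
pose part (s : seq 'I_n) := \matrix_(i, j) (A i j + if i \in s then u i 0 * w 0 j else 0).
have det_setrow i : \det (setrow A i) = (w *m \adj A) 0 i.
  rewrite (expand_det_row _ i) mxE; apply: eq_bigr => j _; rewrite !mxE eqxx.
  congr (_ * (_ * \det _)); apply/matrixP => k l; rewrite !mxE.
  by rewrite eq_sym (negPf (neq_lift _ _)).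
have det_setrow_part (s : seq 'I_n) i :
    i \notin s -> \det (setrow (part s) i) = \det (setrow A i).
  move=> iNs; pose x : 'cV[R]_n := \col_k (if k \in s then u k 0 else 0).
  have -> : setrow (part s) i = (1%:M + x *m delta_mx 0 i) *m setrow A i.
    rewrite mulmxDl mul1mx -mulmxA -rowE; apply/matrixP => k j.
    rewrite !mxE big_ord1 !mxE eqxx; case: (eqVneq k i) => [->|_].
      by rewrite (negPf iNs) mul0r addr0.
    by case: ifP; rewrite ?mul0r.
  by rewrite det_mulmx det_1D_col_row -rowE !mxE (negPf iNs) addr0 mul1r.
have det_part (s : seq 'I_n) : uniq s ->
    \det (part s) = \det A + \sum_(i <- s) (w *m \adj A) 0 i * u i 0.
  elim: s => [_|i s IHs /= /andP[iNs /IHs{}IHs]].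
    rewrite big_nil addr0; congr (\det _); apply/matrixP => i j.
    by rewrite !mxE addr0.
  rewrite big_cons addrCA -IHs addrC -det_setrow -(det_setrow_part s) //.
  rewrite mulrC -[\det (part s)]mul1r.
  apply: (determinant_multilinear (i0 := i)).
  - apply/rowP => j; rewrite !mxE inE !eqxx (negPf iNs) /=.
    by rewrite addr0 mul1r.
  - apply/matrixP => k j; rewrite !mxE inE.
    by rewrite [lift i k == i]eq_sym (negPf (neq_lift _ _)).
  - apply/matrixP => k j; rewrite !mxE inE.
    by rewrite [lift i k == i]eq_sym (negPf (neq_lift _ _)).
rewrite [in RHS]mxE -big_enum -det_part ?enum_uniq //=.
congr (\det _); apply/matrixP => i j.
by rewrite !mxE mem_enum big_ord1.
Qed.

Lemma det_addJ (R : comPzRingType) (n : nat) (A : 'M[R]_n) (y : R) :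
  \det (A + const_mx y) = \det A + y * cof A.
Proof.
have -> : const_mx y = (y *: (const_mx 1 : 'cV[R]_n)) *m (const_mx 1 : 'rV[R]_n).
  by apply/matrixP => i j; rewrite !mxE big_ord1 !mxE !mulr1.
by rewrite det_addrank1 -scalemxAr mxE.
Qed.

(** Passing from A - J to A and back by [det_addJ] must give the same difference of determinants. *)
Lemma cof_subJ (R : comPzRingType) (n : nat) (A : 'M[R]_n) :
  cof (A - const_mx 1) = cof A.
Proof.
have c1 := det_addJ (A - const_mx 1) 1; rewrite subrK mul1r in c1.
have c2 := det_addJ A (-1); rewrite (raddfN const_mx) mulN1r in c2.
by apply: (addrI (\det A - cof A)); rewrite -{1}c2 -c1 subrK.
Qed.

Lemma cofZ (R : comPzRingType) (n : nat) (a : R) (A : 'M[R]_n) :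
  cof (a *: A) = a ^+ (n - 1) * cof A.
Proof. by rewrite /cof adjZ subn1 -scalemxAr -scalemxAl mxE. Qed.

(** * Gluing at a cut-vertex *)

Section Gluing.

Variables (R : comPzRingType) (n : nat) (D M : 'I_n -> 'I_n -> R).
Implicit Types (U A B : {set 'I_n}) (v : 'I_n) (N : 'I_n -> 'I_n -> R).

Lemma pminor0 N : pminor set0 N = 1.
Proof.
rewrite /pminor -(det1 R n); congr (\det _); apply/matrixP => i j.
by rewrite !mxE inE.
Qed.

(** The shape of D + yJ once it is cleared with row and column [v]: a core [N] on the other indices,
    bordered in position [v]. *)
Definition border v (b c : 'I_n -> R) (s : R) N : 'I_n -> 'I_n -> R :=
  fun i j => if i == v then (if j == v then s else c j)
             else if j == v then b i else N i j.

(** Row [v] is split into its part on [A] and its part on [B :\ v]; each summand is block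
    triangular. The corner [s] goes with [A], hence the corner 0 on the side of [B]. *)
Lemma pminor_border_glue A B v b c s N :
  A :&: B = [set v] ->
  (forall i j, i \in A :\ v -> j \in B :\ v -> N i j = 0) ->
  (forall i j, i \in B :\ v -> j \in A :\ v -> N i j = 0) ->
  pminor (A :|: B) (border v b c s N) =
  pminor A (border v b c s N) * pminor (B :\ v) N +
  pminor (A :\ v) N * pminor B (border v b c 0 N).
Proof.
move=> AB NAB NBA.
have ABv x : (x \in A) && (x \in B) = (x == v).
  by rewrite -in_setI AB inE.
have [vA vB] : v \in A /\ v \in B by apply/andP; rewrite ABv.
have AnB x : x \in A -> x != v -> x \in B = false.
  by move=> xA xv; have := ABv x; rewrite xA (negPf xv).
have BnA x : x \in B -> x != v -> x \in A = false.
  by move=> xB xv; have := ABv x; rewrite xB andbT (negPf xv).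
pose r j := if j == v then s else c j.
have := @pminor_rowD _ _ (A :|: B) v (border v b c s N)
  (fun j => if j \in B :\ v then 0 else r j)
  (fun j => if j \in B :\ v then r j else 0).
rewrite inE vA => /(_ isT) eqD.
rewrite -[LHS](_ : pminor (A :|: B) (fun i j => if i == v then
  (if j \in B :\ v then 0 else r j) + (if j \in B :\ v then r j else 0)
  else border v b c s N i j) = _); last first.
  apply: eq_pminor => i j _ _; rewrite /border /r.
  by case: (eqVneq i v) => // _; case: ifP; rewrite ?add0r ?addr0.
rewrite {}eqD; congr (_ + _).
- have -> : A :|: B = A :|: B :\ v.
    by apply/setP => x; rewrite !inE; case: eqP => // ->; rewrite vA.
  rewrite pminorU.
  + congr (_ * _); apply: eq_pminor => i j; rewrite !inE.
    * move=> iA jA; rewrite /border /r; case: (eqVneq i v) => // _.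
      by case: (eqVneq j v) => //= jv; rewrite (AnB j).
    * by move=> /andP[iv iB] /andP[jv jB]; rewrite /border !ifN.
  + rewrite disjoint_subset; apply/subsetP => x xA; rewrite !inE.
    by case: (eqVneq x v) => //= xv; rewrite (AnB x).
  + move=> i j iA jB; have := jB; rewrite !inE => /andP[jv jB'].
    rewrite jv jB' /= /border (negPf jv).
    by case: (eqVneq i v) => // iv; rewrite NAB // !inE iv.
- have -> : A :|: B = B :|: A :\ v.
    by apply/setP => x; rewrite !inE orbC; case: eqP => // ->; rewrite vB.
  rewrite pminorU 1?mulrC.
  + congr (_ * _); apply: eq_pminor => i j; rewrite !inE.
    * by move=> /andP[iv iB] /andP[jv jB]; rewrite /border !ifN.
    * move=> iA jB; rewrite /border /r; case: (eqVneq i v) => // _.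
      by rewrite jB; case: (eqVneq j v) => //= jv; rewrite ?orbT.
  + rewrite disjoint_subset; apply/subsetP => x xA; rewrite !inE.
    by case: (eqVneq x v) => //= xv; rewrite (BnA x).
  + move=> i j iB jA; have := jA; rewrite !inE => /andP[jv jA'].
    rewrite (AnB j) // andbF /= /border (negPf jv).
    by case: (eqVneq i v) => iv; [rewrite if_same | rewrite NBA // !inE iv].
Qed.

Definition schur v i j : R := D i j - D i v - M i v * D v j.

Definition kappa_on U v : R := pminor (U :\ v) (schur v).

(** Subtracting [M i v] times row [v], and then column [v] from the other columns, cancels y in the
    core; it survives only in the corner and in the border column. *)
Lemma pminor_add_border U v y :
  v \in U -> D v v = 0 ->
  pminor U (fun i j => D i j + y) =
  pminor U (border v (fun i => D i v + y * (1 - M i v)) (D v) y (schur v)).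
Proof.
move=> vU Dvv.
rewrite -(@pminor_row_op _ _ U v (fun i => if i == v then 0 else M i v)) ?eqxx //.
rewrite -(@pminor_col_op _ _ U v (fun j => if j == v then 0 else 1)) ?eqxx //.
apply: eq_pminor => i j _ _; rewrite /border /schur.
by case: (eqVneq i v) => [->|_]; case: (eqVneq j v) => [->|_]; rewrite ?Dvv; ring.
Qed.

(** The case of [pminor_border_glue] in which one side is the single vertex [v]. *)
Lemma pminor_border0 U v b c s N :
  v \in U ->
  pminor U (border v b c s N) =
  s * pminor (U :\ v) N + pminor U (border v b c 0 N).
Proof.
move=> vU; rewrite -{1}(setUidPr (_ : [set v] \subset U)) ?sub1set //.
rewrite pminor_border_glue.
- rewrite pminor1 /border eqxx; congr (_ + _).
  by rewrite setDv pminor0 mul1r.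
- by apply/setIidPl; rewrite sub1set.
- by move=> i j; rewrite setDv inE.
- by move=> i j _; rewrite setDv inE.
Qed.

Section GluingAt.

Variables (A B : {set 'I_n}) (v : 'I_n).
Hypotheses (AB : A :&: B = [set v]) (Mvv : M v v = 1) (Dvv : D v v = 0).
Hypothesis MAB : forall i j, i \in A -> j \in B -> M i j = M i v * M v j.
Hypothesis MBA : forall i j, i \in B -> j \in A -> M i j = M i v * M v j.
Hypothesis DAB : forall i j, i \in A -> j \in B -> D i j = D i v + M i v * D v j.
Hypothesis DBA : forall i j, i \in B -> j \in A -> D i j = D i v + M i v * D v j.

Let ABv x : (x \in A) && (x \in B) = (x == v).
Proof. by rewrite -in_setI AB inE. Qed.

Let schurAB i j : i \in A -> j \in B -> schur v i j = 0.
Proof. by move=> iA jB; rewrite /schur DAB //; ring. Qed.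

Let schurBA i j : i \in B -> j \in A -> schur v i j = 0.
Proof. by move=> iB jA; rewrite /schur DBA //; ring. Qed.

(** Both sides share only the border. Gluing leaves the corner y on [A] and 0 on [B]; restoring y on
    [B] by [pminor_border0] costs the last term. *)
Lemma pminor_add_glue y :
  pminor (A :|: B) (fun i j => D i j + y) =
  pminor A (fun i j => D i j + y) * kappa_on B v +
  kappa_on A v * pminor B (fun i j => D i j + y) -
  y * (kappa_on A v * kappa_on B v).
Proof.
have [vA vB] : v \in A /\ v \in B by apply/andP; rewrite ABv.
rewrite !(@pminor_add_border _ v) // ?inE ?vA //.
rewrite pminor_border_glue //.
- by rewrite (@pminor_border0 B _ _ _ y) // -/(kappa_on B v) -/(kappa_on A v); ring.
- by move=> i j; rewrite !inE => /andP[_ iA] /andP[_ jB]; apply: schurAB.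
- by move=> i j; rewrite !inE => /andP[_ iA] /andP[_ jB]; apply: schurBA.
Qed.

(** For [v0 = v] the matrix is already block triangular. Otherwise row [v] is still present, and
    subtracting [M i v] times it from the rows of [B :\ v] annihilates their entries in the columns
    of [A] and turns [schur v0] into [schur v] on [B :\ v]. *)
Lemma kappa_on_glue v0 :
  v0 \in A -> kappa_on (A :|: B) v0 = kappa_on A v0 * kappa_on B v.
Proof.
move=> v0A; have [vA vB] : v \in A /\ v \in B by apply/andP; rewrite ABv.
have AnB x : x \in A -> x != v -> x \in B = false.
  by move=> xA xv; have := ABv x; rewrite xA (negPf xv).
have dis U : U \subset A -> [disjoint B :\ v & U].
  move=> UA; rewrite disjoint_subset; apply/subsetP => x; rewrite !inE.
  move=> /andP[xv xB]; apply/negP => /(subsetP UA) xA.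
  by rewrite (AnB x) in xB.
have AB' : (A :|: B) :\ v0 = (B :\ v) :|: (A :\ v0).
  apply/setP => x; rewrite !inE; case: (eqVneq x v0) => [->|_] /=.
    have := ABv v0; rewrite v0A /= => ->; rewrite orbF.
    by case: (eqVneq v0 v).
  by case: (eqVneq x v) => [->|_] //=; rewrite ?vA // orbC.
rewrite /kappa_on AB'.
have [e|v0v] := eqVneq v0 v.
  rewrite e pminorU 1?mulrC //; first by apply: dis; apply: subsetDl.
  by move=> i j; rewrite !inE => /andP[_ iB] /andP[_ jA]; apply: schurBA.
rewrite -(@pminor_row_op _ _ _ v (fun i => if i \in B :\ v then M i v else 0)); last 2 first.
- by rewrite !inE eqxx vA eq_sym v0v.
- by rewrite !inE eqxx.
rewrite pminorU 1?mulrC; first congr (_ * _).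
- apply: eq_pminor => i j; rewrite !inE => /andP[_ iA] _.
  case: ifP => [/andP[iv iB]|_]; last by rewrite mul0r subr0.
  by rewrite (AnB i) in iB.
- apply: eq_pminor => i j iB; rewrite iB; move: iB.
  rewrite !inE => /andP[_ iB] /andP[_ jB]; rewrite /schur.
  by rewrite (DBA iB v0A) (MBA iB v0A) (DAB v0A jB); ring.
- by apply: dis; apply: subsetDl.
- move=> i j iB; rewrite iB; move: iB.
  rewrite !inE => /andP[_ iB] /andP[_ jA]; rewrite /schur.
  by rewrite (DBA iB v0A) (MBA iB v0A) (DBA iB jA); ring.
Qed.

End GluingAt.

End Gluing.

(** Serves both for the whole graph, with [f] the identity, and for a block, with [f] its
    [enum_val]. *)
Lemma kappa_mxsub (R : comPzRingType) (n k : nat) (f : 'I_k -> 'I_n)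
    (U : {set 'I_n}) (D M : 'I_n -> 'I_n -> R) (Df Mf : 'M[R]_k) (v0 : 'I_k) :
  injective f -> (forall x, (x \in U) = (x \in codom f)) ->
  (forall i j, Df i j = D (f i) (f j)) ->
  (forall i j, Mf i j = M (f i) (f j)) ->
  kappa Df Mf v0 = kappa_on D M U (f v0).
Proof.
move=> f_inj fU eD eM; rewrite /kappa_on.
rewrite -(@det_mxsub_pminor _ _ _ (fun i => f (lift v0 i))).
- rewrite /kappa; congr (\det _); apply/matrixP => i j.
  by rewrite !mxE !big_ord1 !mxE mulr1 !eD !eM.
- by move=> i j /f_inj /lift_inj.
- move=> x; rewrite !inE fU; apply/andP/codomP => [[xv /codomP[i ei]]|[i ->]].
    rewrite ei (inj_eq f_inj) eq_sym in xv.
    by have [j ej _] := unlift_some xv; exists j; rewrite -ej.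
  by rewrite (inj_eq f_inj) eq_sym neq_lift codom_f.
Qed.

Lemma kappa_one_block (R : comPzRingType) (p : nat) (a : R) (M : 'M[R]_p)
    (v0 : 'I_p) :
  (forall i, M i i = 1) ->
  kappa (a *: (M - const_mx 1)) M v0 = a ^+ (p - 1) * \det M.
Proof.
move=> M1.
rewrite (@kappa_mxsub _ _ _ id [set: 'I_p]
  (fun i j => a * (M i j - 1)) (fun i j => M i j)) //; last first.
- by move=> i j; rewrite !mxE.
- by move=> x; rewrite inE; apply/esym/codomP; exists x.
rewrite /kappa_on.
rewrite (@eq_pminor _ _ _ _ (fun i j => a * (M i j - M i v0 * M v0 j))); last first.
  by move=> i j _ _; rewrite /schur; ring.
rewrite pminorZ (_ : #|_| = p - 1)%N; last first.
  by rewrite -[in RHS](card_ord p) -cardsT (cardsD1 v0) inE addKn.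
congr (_ * _).
transitivity (pminor [set: 'I_p] (fun i j => M i j)); last first.
  by congr (\det _); apply/matrixP => i j; rewrite !mxE !inE.
(* The diagonal entry 1 at [v0] is the pivot: clearing its column leaves the Schur complement next
   to the 1 by 1 block of [v0]. *)
rewrite -[RHS](@pminor_row_op _ _ _ v0 (fun i => if i == v0 then 0 else M i v0)) ?inE ?eqxx //.
rewrite -[in RHS](setD1K (in_setT v0)) setUC pminorU.
- rewrite pminor1 eqxx mul0r subr0 M1 mulr1; apply: eq_pminor => i j.
  by rewrite !inE => /andP[iv _] _; rewrite (negPf iv).
- by rewrite disjoint_subset; apply/subsetP => x; rewrite !inE => /andP[].
- move=> i j; rewrite !inE => /andP[iv _] /eqP->.
  by rewrite (negPf iv) M1 mulr1 subrr.
Qed.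

(** * Separation and blocks *)

Section Separation.

Local Open Scope nat_scope.

Variables (T : finType) (g : rel T).
Hypothesis g_connected : forall x y : T, connect g x y.

Local Notation G := (whole_graph g).
Local Notation adj := (uadj G).

Lemma uadj_sym (H : sgraph T) : symmetric (uadj H).
Proof. by move=> x y; rewrite /uadj /= orbC. Qed.

Lemma connect_uadjC (H : sgraph T) x y :
  connect (uadj H) x y = connect (uadj H) y x.
Proof. exact: (sym_connect_sym (@uadj_sym H)). Qed.

Lemma adjE x y : adj x y = g x y || g y x.
Proof. by rewrite /uadj /= !inE. Qed.

Lemma connect_adj x y : connect adj x y.
Proof.
apply: connect_sub (g_connected x y) => u w uw; apply: connect1.
by rewrite adjE uw.
Qed.

Lemma uadj_remove (H : sgraph T) v x y :
  uadj (remove_vertex H v) x y = [&& x != v, y != v & uadj H x y].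
Proof.
rewrite /uadj /= !inE /=.
by case: (x != v); case: (y != v); rewrite ?andbT ?andbF.
Qed.

Lemma connect_removeP v x y : x != v ->
  reflect (exists p, [/\ path adj x p, last x p = y & v \notin p])
          (connect (uadj (remove_vertex G v)) x y).
Proof.
move=> xv; apply: (iffP connectP) => [[p pp ->]|[p [pp <- vp]]]; exists p => //.
  split=> //; first by apply: sub_path pp => u w; rewrite uadj_remove => /and3P[].
  elim: p x pp {xv} => //= u p IHp x /andP[]; rewrite uadj_remove.
  by move=> /and3P[_ uv _] /IHp vp; rewrite inE eq_sym (negPf uv).
elim: p x xv pp vp => //= u p IHp x xv /andP[xu pp].
rewrite inE negb_or eq_sym => /andP[uv vp].
by rewrite uadj_remove xv uv xu IHp.
Qed.

Lemma separatesP v i j :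
  reflect [/\ v != i, v != j & ~~ connect (uadj (remove_vertex G v)) i j]
          (separates g v i j).
Proof.
apply: (iffP and4P) => [[? ? _ ?]|[vi vj nc]]; split=> //.
rewrite /cut_vertex /verts /= inE /=; apply/forallP => /(_ i).
rewrite !inE eq_sym vi /= => /forallP /(_ j).
by rewrite !inE eq_sym vj (negPf nc).
Qed.

Lemma separatesC v i j : separates g v i j = separates g v j i.
Proof.
by apply/separatesP/separatesP => -[? ? ?]; split; rewrite // connect_uadjC.
Qed.

Lemma separates_mem v i j p :
  separates g v i j -> path adj i p -> last i p = j -> v \in p.
Proof.
move=> /separatesP[vi vj nc] pp lp; apply: contraR nc => vp.
by apply/connect_removeP; [rewrite eq_sym | exists p].
Qed.

Lemma uniq_adj_path i j : exists p, [/\ path adj i p, last i p = j & uniq (i :: p)].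
Proof.
have /connectP[p pp ->] := connect_adj i j.
by have [q pq uq _] := shortenP pp; exists q.
Qed.

(** Every path from i to j runs through v, so its initial part up to v meets w. On a simple path
    that initial part avoids j, which gives [w != j]. *)
Lemma separates_trans v w i j :
  separates g v i j -> separates g w i v -> separates g w i j.
Proof.
move=> svij swiv; have /separatesP[wi wv ncw] := swiv.
have [p [pp lp]] := uniq_adj_path i j; rewrite cons_uniq => /andP[ip up].
have wj : w != j.
  apply: contraNneq ncw => ewj.
  have vp := separates_mem svij pp lp.
  move: pp lp up ip; case/splitPr: p / vp => p1 p2 pp lp up ip.
  apply/connect_removeP; first by rewrite eq_sym.
  exists (rcons p1 v); rewrite last_rcons; split=> //.
    by move: pp; rewrite -cat_rcons cat_path => /andP[].
  move: lp up; rewrite last_cat /= ewj -cat_rcons cat_uniq.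
  case: p2 pp ip => [|u p2] _ _ lp.
    by have /separatesP[_ /eqP[]] := svij.
  by move=> /and3P[_ /hasPn H _]; rewrite -lp; apply: H; apply: (mem_last u).
apply/separatesP; split=> //; apply: contra ncw.
move=> /connect_removeP-/(_ _)[|q [pq lq wq]]; first by rewrite eq_sym.
have vq := separates_mem svij pq lq.
move: pq lq wq; case/splitPr: q / vq => q1 q2 pq lq wq.
apply/connect_removeP; first by rewrite eq_sym.
exists (rcons q1 v); rewrite last_rcons; split=> //.
  by move: pq; rewrite -cat_rcons cat_path => /andP[].
by move: wq; rewrite -cat_rcons mem_cat negb_or => /andP[].
Qed.

Lemma separates_transr v w i j :
  separates g v i j -> separates g w v j -> separates g w i j.
Proof.
rewrite ![separates _ _ i j]separatesC [separates _ _ v j]separatesC.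
exact: separates_trans.
Qed.

(** A simple path from i to j meets both vertices. If it meets a first and b later, its start joins
    i to a without b and its end joins b to j without a; a path from i to b avoiding a, or from a to
    j avoiding b, would then contradict separation. *)
Lemma separates_order v w i j :
  separates g v i j -> separates g w i j -> v != w ->
  separates g v i w && separates g w v j \/
  separates g w i v && separates g v w j.
Proof.
move=> sv sw vw; have [p [pp lp]] := uniq_adj_path i j.
rewrite cons_uniq => /andP[ip up].
have wlog_order a b : separates g a i j -> separates g b i j -> a != b ->
    (exists p1 p2, [/\ p = p1 ++ a :: p2 & b \in p2]) ->
    separates g a i b && separates g b a j.
  move=> sa sb ab [p1 [p2 [ep bp2]]]; subst p.
  have /separatesP[ai aj nca] := sa; have /separatesP[bi bj ncb] := sb.
  move: pp up lp; rewrite -cat_rcons cat_path cat_uniq last_cat last_rcons.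
  move=> /andP[pp1 pp2] /and3P[up1 /hasPn /= H up2] lp.
  have iac : connect (uadj (remove_vertex G b)) i a.
    apply/connect_removeP; first by rewrite eq_sym.
    by exists (rcons p1 a); rewrite last_rcons; split=> //; apply: H.
  have bjc : connect (uadj (remove_vertex G a)) b j.
    move: pp2 up2 lp H {pp1 up1 ip}; case/splitPr: p2 / bp2 => q1 q2 pp2 up2 lp H.
    apply/connect_removeP; first by rewrite eq_sym.
    exists q2; move: pp2 lp; rewrite cat_path last_cat /= => /and3P[_ _ ->] ->.
    split=> //; apply/negP => aq2.
    have := H a; rewrite mem_cat inE aq2 !orbT => /(_ isT).
    by rewrite mem_rcons inE eqxx.
  apply/andP; split; apply/separatesP; split=> //.
  - by apply: contra nca => /connect_trans; apply.
  - by rewrite eq_sym.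
  - by apply: contra ncb; apply: connect_trans.
have vp := separates_mem sv pp lp; have wp := separates_mem sw pp lp.
move: pp lp ip up wp wlog_order; case/splitPr: p / vp => p1 p2 _ _ _ _ wp wlog_order.
move: wp; rewrite mem_cat inE eq_sym (negPf vw) /= => /orP[wp1|wp2]; last first.
  by left; apply: wlog_order => //; exists p1, p2.
right; apply: wlog_order => //; first by rewrite eq_sym.
case/splitPr: p1 / wp1 => q1 q2.
by exists q1, (q2 ++ v :: p2); rewrite -catA /= mem_cat inE eqxx orbT.
Qed.

Lemma nonseparable_connect (K : sgraph T) v x y :
  well_formed K -> subgraph K G -> nonseparable K -> x \in verts K -> y \in verts K ->
  x != v -> y != v -> connect (uadj (remove_vertex G v)) x y.
Proof.
move=> wfK /andP[_ sKG] /andP[ucK /forallP /(_ v)].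
rewrite /cut_vertex negb_and negbK => Kv xK yK xv yv.
have sub : subrel (uadj (remove_vertex K v)) (connect (uadj (remove_vertex G v))).
  move=> a b; rewrite uadj_remove => /and3P[av bv ab]; apply: connect1.
  rewrite uadj_remove av bv /=; move: ab.
  by case/orP => /(subsetP sKG) ab; rewrite /uadj /= ab ?orbT.
apply: (connect_sub sub).
case/orP: Kv => [vK|]; last first.
  move=> /forall_inP/(_ x) H.
  by apply: (forall_inP (H _)); rewrite !inE ?xv ?yv.
have := forall_inP (forall_inP ucK x xK) y yK.
apply: connect_sub => a b ab; apply: connect1.
have vKn c : c \in verts K -> c != v by apply: contraTneq => ->.
rewrite uadj_remove ab andbT.
by case/orP: ab => /(forall_inP wfK) /= /andP[aK bK]; rewrite !vKn.
Qed.

Definition induced (U : {set T}) : sgraph T :=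
  (U, [set p : T * T | [&& p.1 \in U, p.2 \in U & g p.1 p.2]]).

Lemma uadj_induced U x y :
  uadj (induced U) x y = [&& x \in U, y \in U & adj x y].
Proof.
rewrite adjE /uadj /= !inE /=.
by case: (x \in U); case: (y \in U); rewrite ?andbF.
Qed.

Lemma induced_wf U : well_formed (induced U).
Proof. by apply/forall_inP => p; rewrite inE => /and3P[-> ->]. Qed.

Lemma induced_sub U : subgraph (induced U) G.
Proof.
rewrite /subgraph subsetT; apply/subsetP => p.
by rewrite !inE => /and3P[].
Qed.

Lemma sub_induced (K : sgraph T) (U : {set T}) :
  well_formed K -> subgraph K G -> verts K \subset U -> subgraph K (induced U).
Proof.
move=> wfK /andP[_ sK] KU; rewrite /subgraph KU; apply/subsetP => p pK.
have /andP[/(subsetP KU) p1 /(subsetP KU) p2] := forall_inP wfK p pK.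
by have := subsetP sK p pK; rewrite !inE p1 p2.
Qed.

Lemma nonseparable_spanning (K H : sgraph T) :
  verts K = verts H -> arcs K \subset arcs H ->
  nonseparable K -> nonseparable H.
Proof.
move=> eKH aKH /andP[ucK /forallP cutK].
have sub_uc (K' H' : sgraph T) : verts K' = verts H' -> arcs K' \subset arcs H' ->
    uconnected K' -> uconnected H'.
  move=> eK aK uc; apply/forall_inP => x; rewrite -eK => xK.
  apply/forall_inP => y yK.
  have := forall_inP (forall_inP uc x xK) y yK.
  apply: connect_sub => a b ab; apply: connect1; rewrite /uadj /=.
  by case/orP: ab => /(subsetP aK) ->; rewrite ?orbT.
apply/andP; split; first exact: sub_uc ucK.
apply/forallP => v; apply: contra (cutK v).
rewrite /cut_vertex eKH => /andP[->] /=; apply: contra; apply: sub_uc.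
  by rewrite /verts /= -/(verts _) -/(verts _) eKH.
by apply/subsetP => p; rewrite !inE => /andP[/(subsetP aKH) ->].
Qed.

Lemma blockP (e : block g) :
  [/\ well_formed (val e), subgraph (val e) G, nonseparable (val e)
    & forall K, well_formed K -> subgraph K G -> nonseparable K ->
      subgraph (val e) K -> K = val e].
Proof.
have /and4P[? ? ? /forallP maxe] := valP e; split=> // K wfK sK nK seK.
by apply/eqP; apply: (implyP (maxe K)); apply/and4P.
Qed.

(** A nonseparable graph above [K] with the largest number of vertices plus arcs is maximal for
    inclusion, since the order on subgraphs compares both components. *)
Lemma nonseparable_in_block (K : sgraph T) :
  well_formed K -> subgraph K G -> nonseparable K ->
  exists e : block g, subgraph K (val e).
Proof.
move=> wfK sK nK.
pose P (H : {set T} * {set T * T}) :=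
  [&& well_formed H, subgraph H G, nonseparable H & subgraph K H].
have PK : P K by apply/and4P; split=> //; rewrite /subgraph !subxx.
case: (arg_maxnP (P := P) (fun H => #|H.1| + #|H.2|)%N PK) => H /and4P[wH sH nH KH] maxH.
have bH : is_block g H.
  apply/and4P; split=> //; apply/forallP => L; apply/implyP => /and4P[wL sL nL].
  move=> /andP[HL1 HL2].
  have /maxH le : P L.
    apply/and4P; split=> //; have /andP[KH1 KH2] := KH.
    by rewrite /subgraph (subset_trans KH1) ?(subset_trans KH2).
  have l1 := subset_leq_card HL1; have l2 := subset_leq_card HL2.
  rewrite /verts /arcs in HL1 HL2 l1 l2.
  apply/eqP; rewrite [L]surjective_pairing [H]surjective_pairing.
  congr (_, _); apply/esym/eqP; rewrite eqEcard ?HL1 ?HL2 /=.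
    by rewrite -(leq_add2r #|L.2|); apply: leq_trans le _; rewrite leq_add2l.
  by rewrite -(leq_add2l #|L.1|); apply: leq_trans le _; rewrite leq_add2r.
by exists (exist _ H bH).
Qed.

(** The block spans this induced subgraph, and extra arcs on the same vertices keep it nonseparable;
    maximality gives equality. Hence a block is determined by its vertex set. *)
Lemma block_induced (e : block g) : induced (bverts e) = val e.
Proof.
have [wfe se ne maxe] := blockP e.
have ei := sub_induced wfe se (subxx _).
apply: maxe => //; [exact: induced_wf | exact: induced_sub |].
by apply: nonseparable_spanning ne => //; have /andP[] := ei.
Qed.

Lemma bverts_sub_eq (e f : block g) : bverts f \subset bverts e -> f = e.
Proof.
move=> fe; apply: val_inj; have [wfe se ne _] := blockP e.
have [wff sf _ maxf] := blockP f.
by apply/esym/maxf => //; rewrite -[val e]block_induced; apply: sub_induced.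
Qed.

Lemma separates_block v i j (e : block g) :
  separates g v i j -> i \in bverts e -> j \notin bverts e.
Proof.
move=> /separatesP[vi vj nc] ie; apply: contra nc => je.
have [wfe se ne _] := blockP e.
by apply: (nonseparable_connect wfe se ne) => //; rewrite eq_sym.
Qed.

(** A block inside a single vertex x would be contained in the block around an edge at x, against
    maximality. *)
Lemma bverts_gt1 (e : block g) : 1 < #|T| -> 1 < #|bverts e|.
Proof.
move=> T1; rewrite ltnNge; apply/negP => e1.
have [x ex] : exists x, bverts e \subset [set x].
  (* The empty graph is nonseparable in this encoding, so it has to be ruled out as a block too. *)
  case: (set_0Vmem (bverts e)) => [->|[x xe]].
    have /card_gt0P[x _] : 0 < #|T| by apply: leq_trans T1.
    by exists x; apply: sub0set.
  by exists x; rewrite subEproper eq_sym eqEcard sub1set xe cards1 e1.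
have [y xy adjxy] : exists2 y, x != y & adj x y.
  have : 0 < #|[set~ x]| by rewrite cardsC1 -subn1 subn_gt0.
  move=> /card_gt0P[z]; rewrite !inE => zx.
  have [[|u p] [/= pp lp up]] := uniq_adj_path x z; first by rewrite lp eqxx in zx.
  exists u; last by case/andP: pp.
  by move: up; rewrite inE negb_or => /andP[/andP[]].
have nK : nonseparable (induced [set x; y]).
  have yx : adj y x by rewrite uadj_sym.
  apply/andP; split.
    apply/forall_inP => a aK; apply/forall_inP => b bK.
    have [->|ab] := eqVneq a b; first exact: connect0.
    apply: connect1; rewrite uadj_induced aK bK /=.
    move: aK bK ab; rewrite !inE.
    by move=> /orP[] /eqP -> /orP[] /eqP ->; rewrite ?eqxx.
  apply/forallP => v; rewrite /cut_vertex negb_and negbK -implybE.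
  apply/implyP => vK; apply/forall_inP => a; rewrite !inE => /andP[av aK].
  apply/forall_inP => b; rewrite !inE => /andP[bv bK].
  suff -> : a = b by apply: connect0.
  move: vK aK bK av bv; rewrite !inE.
  by move=> /orP[] /eqP -> /orP[] /eqP -> /orP[] /eqP ->; rewrite ?eqxx.
have [f /andP[Kf _]] := nonseparable_in_block (induced_wf _) (induced_sub _) nK.
have ef : e = f.
  apply: bverts_sub_eq; apply: subset_trans ex (subset_trans _ Kf).
  by rewrite sub1set set21.
rewrite ef in e1; have := leq_trans (subset_leq_card Kf) e1.
by rewrite cards2 xy.
Qed.

(* Invariant of the splitting: it makes a cut-vertex of [induced U] separate
   the two sides in the whole graph as well. *)
Definition retract (U : {set T}) (r : T -> T) :=
  [/\ forall x, r x \in U, forall x, x \in U -> r x = x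
    & forall x y, adj x y -> r x = r y \/ (x \in U /\ y \in U)].

Section Part.

Variables (U X : {set T}) (v : T) (r : T -> T).
Hypotheses (rU : retract U r) (XU : X \subset U) (vX : v \in X).
Hypothesis clX : forall a b, a \in X :\ v -> b \in U :\ v -> adj a b -> b \in X.

(** By [clX] the set [X :\ v] is a union of components of [U] without [v], so a path of [induced U]
    towards [v] cannot leave [X] before reaching [v]. *)
Lemma part_uconnected : uconnected (induced U) -> uconnected (induced X).
Proof.
move=> ucU.
suff xv x : x \in X -> connect (uadj (induced X)) x v.
  apply/forall_inP => x /xv xvc; apply/forall_inP => y /xv yvc.
  by apply: connect_trans xvc _; rewrite connect_uadjC.
move=> xX; have vU := subsetP XU v vX.
have /connectP[p pp lp] := forall_inP (forall_inP ucU x (subsetP XU x xX)) v vU.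
elim: p x xX pp lp => [x _ _ ->|y p IHp x xX /= /andP[xy pp] lp].
  exact: connect0.
have [->|xv] := eqVneq x v; first exact: connect0.
move: xy; rewrite uadj_induced => /and3P[xU yU axy].
have yX : y \in X.
  by have [->//|yv] := eqVneq y v; apply: (clX (a := x)); rewrite ?inE ?xv ?yv.
by apply: connect_trans (IHp y yX pp lp); apply: connect1; rewrite uadj_induced xX yX.
Qed.

(** After [r], the rest of [U] is collapsed to [v]. This is consistent because an edge inside [U]
    from [X] to its complement starts at [v]. *)
Lemma part_retract : retract X (fun z => if r z \in X then r z else v).
Proof.
have [r_in r_id r_adj] := rU; split.
- by move=> x; case: ifP.
- by move=> x xX; rewrite r_id ?xX // (subsetP XU).
move=> x y xy; have [->|[xU yU]] := r_adj x y xy; first by left.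
rewrite !r_id //.
have aux a b : a \in X -> b \in U -> b \notin X -> adj a b -> a = v.
  move=> aX bU bX ab; apply/eqP; apply: contraNT (bX) => av.
  apply: (clX (a := a)); rewrite ?inE ?av ?aX ?bU // andbT.
  by apply: contraNneq bX => ->.
case: (boolP (x \in X)) => xX; case: (boolP (y \in X)) => yX.
- by right.
- by left; apply: aux yX xy.
- by left; apply/esym/(aux _ x) => //; rewrite uadj_sym.
- by left.
Qed.

(** Along a path avoiding [v] the image under [r] stays in [X :\ v]: each edge either keeps the
    image or is an edge inside [U], to which [clX] applies. So excursions outside [U] cannot bypass
    [v]. *)
Lemma part_separates i j : i \in X :\ v -> j \in U :\: X -> separates g v i j.
Proof.
have [r_in r_id r_adj] := rU; rewrite !inE => /andP[iv iX] /andP[jX jU].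
apply/separatesP; split; first by rewrite eq_sym.
  by apply: contraNneq jX => <-.
apply/negP => /connect_removeP-/(_ iv) [p [pp lp vp]].
suff H x : r x \in X :\ v -> path adj x p -> v \notin p -> r (last x p) \in X :\ v.
  have := H i; rewrite lp (r_id i) ?(subsetP XU) // (r_id j) //.
  rewrite !in_setD1 iv iX (negPf jX) andbF.
  by move=> /(_ isT pp vp).
elim: p x {pp lp vp} => //= y p IHp x rx /andP[xy pp].
rewrite inE negb_or => /andP[vy vp]; apply: IHp => //.
have [<-//|[xU yU]] := r_adj x y xy.
move: rx; rewrite !r_id // => xX; rewrite !inE eq_sym vy.
by apply: clX xX _ xy; rewrite !inE eq_sym vy.
Qed.

End Part.

(** An induction principle: vertex sets are split at cut-vertices of the subgraphs they induce until
    single blocks remain. The premise in the block case, that no other block shares two vertices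
    with e, makes entries off the diagonal of e unambiguous. *)
Theorem block_decomposition (P : {set T} -> {set block g} -> Prop) :
  (forall e : block g,
     (forall f : block g, 1 < #|bverts f :&: bverts e| -> f = e) ->
     P (bverts e) [set e]) ->
  (forall (A B : {set T}) (EA EB : {set block g}) v,
     A :&: B = [set v] ->
     (forall i j, i \in A :\ v -> j \in B :\ v -> separates g v i j) ->
     [disjoint EA & EB] -> P A EA -> P B EB -> P (A :|: B) (EA :|: EB)) ->
  0 < #|T| -> P [set: T] [set: block g].
Proof.
move=> Pblock Pglue T0.
(* The last premise keeps a block from being cut by [U] in two or more vertices; the alternative
   [U = setT] admits the graph with one vertex. *)
suff main m (U : {set T}) : #|U| < m -> U = setT \/ 1 < #|U| ->
    uconnected (induced U) -> (exists r, retract U r) ->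
    (forall e : block g, 1 < #|bverts e :&: U| -> bverts e \subset U) ->
    P U [set e | bverts e \subset U].
  rewrite (_ : [set: block g] = [set e | bverts e \subset [set: T]]); last first.
    by apply/setP => e; rewrite !inE subsetT.
  apply: (main #|T|.+1); rewrite ?cardsT //; first by left.
  - apply/forall_inP => x _; apply/forall_inP => y _.
    apply: connect_sub (connect_adj x y) => a b ab; apply: connect1.
    by rewrite uadj_induced !inE.
  - by exists id; split=> // *; right; rewrite !inE.
elim: m U => // m IHm U Um U1 ucU [r rU] blU.
case: (boolP [exists v, cut_vertex (induced U) v]) => [/existsP[v]|noCut].
  move=> /andP[vU /forall_inPn[x]]; rewrite !inE => /andP[xv xU].
  move=> /forall_inPn[y]; rewrite !inE => /andP[yv yU] nxy.
  (* The component of x once [v] is removed. Below, [A] is this component with [v] added and [B] is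
     the rest of [U], which contains [v] and y. *)
  pose C := [set z | connect (uadj (remove_vertex (induced U) v)) x z].
  have CU z : z \in C -> z \in U :\ v.
    rewrite inE => /connectP[p pp ->]; elim/last_ind: p pp => [_|p z' _].
      by rewrite !inE xv.
    rewrite rcons_path last_rcons uadj_remove uadj_induced !inE.
    by move=> /andP[_ /and3P[_ -> /and3P[_ ->]]].
  have C_cl a b : a \in U :\ v -> b \in U :\ v -> adj a b -> (a \in C) = (b \in C).
    rewrite !inE => /andP[av aU] /andP[bv bU] ab.
    have step c d : uadj (remove_vertex (induced U) v) c d ->
      connect (uadj (remove_vertex (induced U) v)) x c ->
      connect (uadj (remove_vertex (induced U) v)) x d.
      by move=> cd xc; apply: connect_trans xc (connect1 cd).
    apply/idP/idP; apply: step; rewrite uadj_remove uadj_induced av bv aU bU //.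
    by rewrite uadj_sym.
  have vC : v \notin C by apply/negP => /CU; rewrite !inE eqxx.
  pose A := v |: C; pose B := U :\: C.
  have AU : A \subset U.
    apply/subsetP => z; rewrite in_setU1 => /orP[/eqP->//|/CU].
    by rewrite inE => /andP[].
  have BU : B \subset U by apply: subsetDl.
  have vA : v \in A by rewrite !inE eqxx.
  have vB : v \in B by rewrite in_setD vC.
  have xC : x \in C by rewrite inE connect0.
  have yC : y \notin C by rewrite inE.
  have AB : A :&: B = [set v].
    apply/setP => z; rewrite in_setI in_setU1 in_setD in_set1.
    by case: (eqVneq z v) => [->|_]; rewrite ?vC ?vU //= ; case: (z \in C).
  have AUB : A :|: B = U.
    apply/setP => z; rewrite in_setU in_setU1 in_setD.
    case: (boolP (z \in C)) => [/CU|_] /=; last first.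
      by case: (eqVneq z v) => // ->; rewrite vU.
    by rewrite inE orbT => /andP[_ ->].
  have AC z : (z \in A :\ v) = (z \in C).
    by rewrite in_setD1 in_setU1; case: (eqVneq z v) => //= ->; rewrite (negPf vC).
  have BC z : (z \in B :\ v) = (z \in U :\: A).
    by rewrite in_setD1 !in_setD in_setU1 negb_or andbA.
  have clA a b : a \in A :\ v -> b \in U :\ v -> adj a b -> b \in A.
    rewrite AC => aC bU ab; rewrite in_setU1; apply/orP; right.
    by rewrite -(C_cl a b) // CU.
  have clB a b : a \in B :\ v -> b \in U :\ v -> adj a b -> b \in B.
    rewrite in_setD1 [a \in B]in_setD => /and3P[av aC aU] bU ab.
    rewrite in_setD -(C_cl a b) ?aC // ?in_setD1 ?av //.
    by move: bU; rewrite in_setD1 => /andP[].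
  have sepAB i j : i \in A :\ v -> j \in B :\ v -> separates g v i j.
    by rewrite BC; apply: part_separates rU AU vA clA i j.
  have T1 : 1 < #|T|.
    apply: leq_trans (max_card [set x; v]).
    by rewrite cards2 xv.
  have block_part (e : block g) : bverts e \subset U ->
      bverts e \subset A \/ bverts e \subset B.
    move=> eU; case: (boolP (bverts e \subset B)) => [|/subsetPn[i ie iB]]; first by right.
    left; apply/subsetP => j je; apply/negPn/negP => jA.
    have iA : i \in A :\ v.
      rewrite AC; move: iB; rewrite in_setD (subsetP eU) // andbT negbK //.
    have jB : j \in B :\ v by rewrite BC in_setD jA (subsetP eU).
    by have := separates_block (sepAB i j iA jB) ie; rewrite je.
  have inner (X Y : {set T}) : X :&: Y = [set v] -> X \subset U ->
      (forall e : block g, bverts e \subset U -> bverts e \subset X \/ bverts e \subset Y) ->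
      forall e : block g, 1 < #|bverts e :&: X| -> bverts e \subset X.
    move=> XY XU part e e1.
    have eU : bverts e \subset U.
      by apply: blU; apply: leq_trans e1 (subset_leq_card _); apply: setIS.
    have [//|eY] := part e eU; move: e1; rewrite ltnNge -(cards1 v) -XY setIC.
    by rewrite subset_leq_card // setIS.
  have gt1 (X : {set T}) z : v \in X -> z \in X -> z != v -> 1 < #|X|.
    move=> vX zX zv; have <- : #|[set z; v]| = 2 by rewrite cards2 zv.
    by apply: subset_leq_card; apply/subsetP => t; rewrite !inE => /orP[]/eqP->.
  have lt_m (X : {set T}) z : X \subset U -> z \in U -> z \notin X -> #|X| < m.
    move=> XU zU zX; rewrite -ltnS; apply: leq_trans Um; rewrite ltnS proper_card //.
    by apply/properP; split=> //; exists z.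
  rewrite -AUB.
  rewrite (_ : [set e | _] = [set e : block g | bverts e \subset A]
                         :|: [set e : block g | bverts e \subset B]); last first.
    apply/setP => e; rewrite !inE; apply/idP/orP.
      by rewrite AUB => /block_part.
    by case=> H; apply: subset_trans H _; [apply: subsetUl | apply: subsetUr].
  apply: (Pglue _ _ _ _ v) => //.
  (* A block inside both [A] and [B] would have at most the vertex [v]. *)
  - rewrite disjoint_subset; apply/subsetP => e; rewrite !inE => eA.
    apply/negP => eB; have := bverts_gt1 e T1; rewrite ltnNge -(cards1 v) -AB.
    by rewrite subset_leq_card // subsetI eA.
  - apply: IHm.
    + by apply: (lt_m A y) => //; rewrite in_setU1 negb_or yv.
    + by right; apply: (gt1 A x) => //; rewrite in_setU1 xC orbT.
    + exact: part_uconnected AU vA clA ucU.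
    + by eexists; apply: part_retract rU AU vA clA.
    + by apply: (inner A B).
  - apply: IHm.
    + by apply: (lt_m B x) => //; rewrite in_setD xC.
    + by right; apply: (gt1 B y) => //; rewrite in_setD yC.
    + exact: part_uconnected BU vB clB ucU.
    + by eexists; apply: part_retract rU BU vB clB.
    + apply: (inner B A) => //; first by rewrite setIC.
      by move=> e /block_part[]; [right | left].
(* Without a cut-vertex [U] lies in a block, and the invariant on blocks forces equality. *)
have nU : nonseparable (induced U) by rewrite /nonseparable ucU -negb_exists.
have [e /andP[Ue _]] := nonseparable_in_block (induced_wf _) (induced_sub _) nU.
have eU : bverts e = U.
  apply/eqP; rewrite eqEsubset andbC; apply/andP; split; first exact: Ue.
  case: U1 => [->|U1]; first exact: subsetT.
  by apply: blU; rewrite (setIidPr Ue).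
rewrite -eU in blU *.
rewrite (_ : [set f | _] = [set e]); last first.
  apply/setP => f; rewrite !inE; apply/idP/eqP => [/bverts_sub_eq //|->].
  exact: subxx.
by apply: Pblock => f /blU /bverts_sub_eq.
Qed.

End Separation.

(** * Glued matrices *)

Section Glue.

Variables (R : comPzRingType) (n : nat) (g : rel 'I_n).
Hypothesis g_connected : forall x y : 'I_n, connect g x y.
Variables (B : forall e : block g, 'M[R]_(bsize e)).
Variable op : 'I_n -> 'I_n -> R -> R -> R.

Let separators i j := [set v | separates g v i j].

(** The termination measure of [glue]: separators of (i, v) also separate i from j, and [v] itself
    drops out. *)
Lemma separators_ltl v i j :
  separates g v i j -> (#|separators i v| < #|separators i j|)%N.
Proof.
move=> sv; apply: proper_card; apply/properP; split.
  by apply/subsetP => w; rewrite !inE; apply: separates_trans.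
exists v; rewrite !inE //; apply/negP => /separatesP[_].
by rewrite eqxx.
Qed.

Lemma separators_ltr v i j :
  separates g v i j -> (#|separators v j| < #|separators i j|)%N.
Proof.
move=> sv; apply: proper_card; apply/properP; split.
  by apply/subsetP => w; rewrite !inE; apply: separates_transr.
exists v; rewrite !inE //; apply/negP => /separatesP[].
by rewrite eqxx.
Qed.

(** Each recursive call spends one unit of fuel and lowers the number of separating vertices by at
    least one. *)
Lemma glue_fuel k k' i j :
  (#|separators i j| <= k)%N -> (#|separators i j| <= k')%N ->
  glue B op k i j = glue B op k' i j.
Proof.
elim: k k' i j => [|k IHk] [|k'] i j //= lek lek'; case: pickP => // _;
  case: pickP => // v sv.
- by have := leq_trans (separators_ltl sv) lek.
- by have := leq_trans (separators_ltl sv) lek'.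
congr op; apply: IHk; rewrite -ltnS.
- exact: leq_trans (separators_ltl sv) lek.
- exact: leq_trans (separators_ltl sv) lek'.
- exact: leq_trans (separators_ltr sv) lek.
- exact: leq_trans (separators_ltr sv) lek'.
Qed.

Lemma glue_unfold k v i j :
  (#|separators i j| <= k)%N -> separates g v i j ->
  exists2 w, separates g w i j &
    glue B op k i j = op i w (glue B op k i w) (glue B op k w j).
Proof.
move=> lek sv.
have [w sw eqw] : exists2 w, separates g w i j &
    glue B op k i j = op i w (glue B op k.-1 i w) (glue B op k.-1 w j).
  case: k lek => [|k] lek; first by have := leq_trans (separators_ltl sv) lek.
  rewrite [glue _ _ _ i j]/=; case: pickP => [e /andP[ie je]|_].
    by have := separates_block sv ie; rewrite je.
  by case: pickP => [w sw|/(_ v)]; [exists w | rewrite sv].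
exists w => //; rewrite eqw; congr op; apply: glue_fuel.
- by rewrite -ltnS (leq_trans (separators_ltl sw)) // (leq_trans lek) ?leqSpred.
- exact: leq_trans (ltnW (separators_ltl sw)) lek.
- by rewrite -ltnS (leq_trans (separators_ltr sw)) // (leq_trans lek) ?leqSpred.
- exact: leq_trans (ltnW (separators_ltr sw)) lek.
Qed.

(** For the additive operation this law amounts to m_iw = m_iv m_vw, whence the condition that v
    separates i from w. *)
Hypothesis op_assoc : forall i v w x y z, separates g v i w ->
  op i v x (op v w y z) = op i w (op i v x y) z.

(** Independence of the choice of cut-vertex. The picked w and the given v occur in a definite order
    between i and j; expanding at both, by induction on the number of separators, gives two
    bracketings of the same triple. *)
Lemma glue_separates k v i j :
  (#|separators i j| <= k)%N -> separates g v i j ->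
  glue B op k i j = op i v (glue B op k i v) (glue B op k v j).
Proof.
have [m] := ubnP #|separators i j|.
elim: m => // m IHm in v i j *; rewrite ltnS => lem lek sv.
have [w sw ->] := glue_unfold lek sv.
have IHl x u : separates g u i j -> separates g x i u ->
    glue B op k i u = op i x (glue B op k i x) (glue B op k x u).
  move=> su sx; have lt := separators_ltl su.
  by apply: IHm sx; [apply: leq_trans lem | apply: leq_trans (ltnW lt) lek].
have IHr x u : separates g u i j -> separates g x u j ->
    glue B op k u j = op u x (glue B op k u x) (glue B op k x j).
  move=> su sx; have lt := separators_ltr su.
  by apply: IHm sx; [apply: leq_trans lem | apply: leq_trans (ltnW lt) lek].
have [->//|wv] := eqVneq w v.
have [/andP[s1 s2]|/andP[s1 s2]] := separates_order g_connected sw sv wv.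
  by rewrite (IHl w v) // (IHr v w) // op_assoc.
by rewrite (IHl v w) // (IHr w v) // op_assoc.
Qed.

Lemma block_entryE (e : block g) (A : 'M[R]_(bsize e)) i j :
  block_entry A (enum_val i) (enum_val j) = A i j.
Proof.
rewrite /block_entry (big_pred1 i) => [|k]; last by rewrite (inj_eq enum_val_inj).
by rewrite (big_pred1 j) // => k; rewrite (inj_eq enum_val_inj).
Qed.

(** Off the diagonal, any block that [pick] returns shares two vertices with [e] and so is [e]. On
    the diagonal it may be another block, but all diagonal entries equal [c]. *)
Lemma glue_block k (e : block g) (c : R) i j :
  (forall (f : block g) i, B f i i = c) ->
  (forall f : block g, (1 < #|bverts f :&: bverts e|)%N -> f = e) ->
  glue B op k (enum_val i) (enum_val j) = B e i j.
Proof.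
move=> Bc e_uniq.
have iE := enum_valP i; have jE := enum_valP j.
suff body z : (if [pick f : block g | (enum_val i \in bverts f) && (enum_val j \in bverts f)]
     is Some f then block_entry (B f) (enum_val i) (enum_val j) else z) = B e i j.
  by case: k => [|k]; apply: body.
case: pickP => [f /andP[fi fj]|/(_ e)]; last by rewrite iE jE.
have [eij|ij] := eqVneq i j.
  rewrite -eij Bc; rewrite -(enum_rankK_in fi fi) block_entryE; exact: Bc.
have ef : f = e.
  apply: e_uniq; have <- : #|[set enum_val i; enum_val j]| = 2%N.
    by rewrite cards2 (inj_eq enum_val_inj) ij.
  apply: subset_leq_card; apply/subsetP => x; rewrite !inE.
  by move=> /orP[]/eqP->; rewrite ?fi ?fj ?iE ?jE.
by rewrite ef block_entryE.
Qed.

End Glue.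

(** * Products and Leibniz sums over sets of blocks *)

Section BlockSums.

Variables (R : comPzRingType) (I : finType) (t k : I -> R).

Lemma prod_setU (A B : {set I}) :
  [disjoint A & B] ->
  \prod_(e in A :|: B) k e = (\prod_(e in A) k e) * \prod_(e in B) k e.
Proof.
by move=> dAB; rewrite -bigU //; apply: eq_bigl => e; rewrite !inE.
Qed.

(** Leibniz rule: the sum is the coefficient of x in the product of all [k e + t e * x]. *)
Lemma sum_prod_setU (A B : {set I}) :
  [disjoint A & B] ->
  \sum_(e in A :|: B) t e * \prod_(f in A :|: B | f != e) k f =
  (\sum_(e in A) t e * \prod_(f in A | f != e) k f) * \prod_(e in B) k e +
  (\prod_(e in A) k e) * \sum_(e in B) t e * \prod_(f in B | f != e) k f.
Proof.
move=> dAB.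
have side (C D : {set I}) e : [disjoint C & D] -> e \in C ->
    \prod_(f in C :|: D | f != e) k f =
    (\prod_(f in C | f != e) k f) * \prod_(f in D) k f.
  move=> dCD eC; rewrite (bigID (fun f => f \in C)) /=; congr (_ * _).
    by apply: eq_bigl => f; rewrite inE; case: (f \in C); rewrite ?andbT ?andbF.
  apply: eq_bigl => f; rewrite inE; case: (boolP (f \in C)) => fC /=.
    by rewrite andbF (disjointFr dCD).
  rewrite andbT; case: (eqVneq f e) => [ef|]; last by rewrite andbT.
  by rewrite ef eC in fC.
transitivity (\sum_(e in [predU A & B]) t e * \prod_(f in A :|: B | f != e) k f).
  by apply: eq_bigl => e; rewrite !inE.
rewrite bigU //; congr (_ + _).
  by rewrite mulr_suml; apply: eq_bigr => e eA; rewrite side // mulrA.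
rewrite mulr_sumr; apply: eq_bigr => e eB.
by rewrite setUC side 1?disjoint_sym //; ring.
Qed.

End BlockSums.

(** * The identities by induction along the block decomposition *)

Section MainIdentities.

Variables (R : comPzRingType) (n : nat) (g : rel 'I_n).
Hypotheses (n_gt0 : (0 < n)%N) (g_connected : forall x y : 'I_n, connect g x y).
Variables (a : block g -> R) (Dst : forall e : block g, 'M[R]_(bsize e)).
Hypothesis Dst_diag : forall (e : block g) i, Dst e i i = 1.
(** Only the block values and the gluing laws are assumed, so that the results apply both to the
    additive-multiplicative distance matrix and to M - J. *)
Variables D M : 'I_n -> 'I_n -> R.
Hypothesis M_block : forall (e : block g) i j,
  (forall f : block g, (1 < #|bverts f :&: bverts e|)%N -> f = e) ->
  M (enum_val i) (enum_val j) = Dst e i j.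
Hypothesis D_block : forall (e : block g) i j,
  (forall f : block g, (1 < #|bverts f :&: bverts e|)%N -> f = e) ->
  D (enum_val i) (enum_val j) = block_add_dist a Dst e i j.
Hypothesis M_separates : forall v i j,
  separates g v i j -> M i j = M i v * M v j.
Hypothesis D_separates : forall v i j,
  separates g v i j -> D i j = D i v + M i v * D v j.

Let De := block_add_dist a Dst.
Let kE (e : block g) := a e ^+ (bsize e - 1) * \det (Dst e).

(** Once y times kappa is subtracted from det(D + yJ), the law of [pminor_add_glue] becomes a
    Leibniz rule; this is why y [kE] is subtracted in each summand and added back in front. *)
Let main_at (y : R) (U : {set 'I_n}) (E : {set block g}) : Prop :=
  [/\ forall v, v \in U -> M v v = 1 /\ D v v = 0,
      forall v, v \in U -> kappa_on D M U v = \prod_(e in E) kE e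
    & pminor U (fun i j => D i j + y) =
      y * \prod_(e in E) kE e +
      \sum_(e in E) (\det (De e + const_mx y) - y * kE e) *
        \prod_(f in E | f != e) kE f].

Let main_whole y : main_at y setT setT.
Proof.
apply: (block_decomposition g_connected); last by rewrite card_ord.
- move=> e e_uniq.
  have enumE (x : 'I_n) : x \in bverts e -> exists i : 'I_(bsize e), x = enum_val i.
    by move=> xe; exists (enum_rank_in xe x); rewrite enum_rankK_in.
  have eU x : (x \in bverts e) = (x \in codom (enum_val (A := mem (bverts e)))).
    by apply/idP/codomP => [/enumE//|[i ->]]; apply: enum_valP.
  split.
  + move=> v /enumE[i ->]; rewrite M_block // D_block // !mxE Dst_diag.
    by rewrite subrr mulr0.
  + move=> v /enumE[i ->]; rewrite big_set1 /kE -(kappa_one_block _ i) //.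
    apply/esym; apply: (kappa_mxsub _ enum_val_inj eU) => k l.
      by rewrite D_block.
    by rewrite M_block.
  + rewrite !big_set1 big_pred0 => [|f]; last by rewrite inE; case: eqP.
    rewrite mulr1 addrCA subrr addr0.
    rewrite -(det_mxsub_pminor _ enum_val_inj eU); congr (\det _).
    by apply/matrixP => i j; rewrite [LHS]mxE D_block // [RHS]mxE; congr (_ + _); rewrite mxE.
- move=> A B EA EB v AB sepAB dE [diagA kA pA] [diagB kB pB].
  have [vA vB] : v \in A /\ v \in B.
    by apply/andP; rewrite -in_setI AB inE.
  have [Mvv Dvv] := diagA v vA.
  (* Separation covers i and j distinct from [v]; at [v] itself the laws come from [M v v = 1] and
     [D v v = 0]. *)
  have laws i j : i \in A -> j \in B ->
      [/\ M i j = M i v * M v j, M j i = M j v * M v i,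
          D i j = D i v + M i v * D v j & D j i = D j v + M j v * D v i].
    move=> iA jB.
    have [->|iv] := eqVneq i v; first by rewrite Mvv Dvv !mul1r !mulr1 mulr0 add0r addr0.
    have [->|jv] := eqVneq j v; first by rewrite Mvv Dvv !mul1r !mulr1 mulr0 add0r addr0.
    have sij : separates g v i j by apply: sepAB; rewrite !inE ?iv ?jv.
    have sji : separates g v j i by rewrite separatesC.
    by split; rewrite -?M_separates -?D_separates.
  have MAB i j : i \in A -> j \in B -> M i j = M i v * M v j.
    by move=> iA jB; have [] := laws i j iA jB.
  have MBA i j : i \in B -> j \in A -> M i j = M i v * M v j.
    by move=> iB jA; have [] := laws j i jA iB.
  have DAB i j : i \in A -> j \in B -> D i j = D i v + M i v * D v j.
    by move=> iA jB; have [] := laws i j iA jB.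
  have DBA i j : i \in B -> j \in A -> D i j = D i v + M i v * D v j.
    by move=> iB jA; have [] := laws j i jA iB.
  split.
  + by move=> x; rewrite inE => /orP[/diagA|/diagB].
  + move=> x; rewrite inE prod_setU // => /orP[xA|xB].
      by rewrite (kappa_on_glue AB) // kA // kB.
    rewrite setUC (@kappa_on_glue _ _ D M B A v) //; last by rewrite setIC.
    by rewrite kA // kB // mulrC.
  + rewrite (pminor_add_glue AB Dvv DAB DBA) kA // kB // pA pB.
    by rewrite prod_setU // sum_prod_setU //; ring.
Qed.

Let setT_prod (k : block g -> R) : \prod_(e in [set: block g]) k e = \prod_e k e.
Proof. by apply: eq_bigl => e; rewrite inE. Qed.

Lemma kappa_on_whole v : kappa_on D M setT v = \prod_e kE e.
Proof. by have [_ -> //] := main_whole 0; rewrite setT_prod. Qed.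

Lemma pminor_add_whole y :
  pminor setT (fun i j => D i j + y) =
  y * \prod_e kE e +
  \sum_e (\det (De e + const_mx y) - y * kE e) * \prod_(f | f != e) kE f.
Proof.
have [_ _ ->] := main_whole y; rewrite setT_prod; congr (_ + _).
apply: eq_big => [e|e _]; first by rewrite inE.
by congr (_ * _); apply: eq_bigl => f; rewrite inE.
Qed.

Let Dmx := \matrix_(i, j) D i j.

Let det_add y : \det (Dmx + const_mx y) = pminor setT (fun i j => D i j + y).
Proof. by congr (\det _); apply/matrixP => i j; rewrite !mxE !inE. Qed.

Lemma det_whole :
  \det Dmx = \sum_e \det (De e) * \prod_(f | f != e) kE f.
Proof.
have := det_add 0; rewrite det_addJ mul0r addr0 => ->.
rewrite pminor_add_whole mul0r add0r; apply: eq_bigr => e _.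
by rewrite det_addJ !mul0r addr0 subr0.
Qed.

(** At y = 1 the determinant is [\det Dmx + cof Dmx], from which [det_whole] is subtracted. *)
Lemma cof_whole :
  cof Dmx = \prod_e kE e + \sum_e (cof (De e) - kE e) * \prod_(f | f != e) kE f.
Proof.
have := det_add 1; rewrite det_addJ mul1r pminor_add_whole mul1r det_whole.
move=> /(canRL (addKr _)) ->; rewrite addrCA; congr (_ + _).
rewrite addrC -sumrB; apply: eq_bigr => e _.
by rewrite det_addJ !mul1r -mulrBl; congr (_ * _); ring.
Qed.

End MainIdentities.

Theorem theorem1 (R : comPzRingType) (n : nat) (g : rel 'I_n)
    (a : block g -> R) (Dst : forall e : block g, 'M[R]_(bsize e))
    (n_gt0 : (0 < n)%N)
    (g_simple : irreflexive g)
    (g_strong : forall x y : 'I_n, connect g x y)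
    (Dst_diag : forall (e : block g) (i : 'I_(bsize e)), Dst e i i = 1) :
  let M := mult_dist Dst in
  let D := add_dist a Dst in
  let De := block_add_dist a Dst in
  exists (kG : R) (kE : block g -> R),
    (forall v0 : 'I_n, kappa D M v0 = kG) /\
    kG = \det M * \prod_(e : block g) a e ^+ (bsize e - 1) /\
    (forall (e : block g) (v0 : 'I_(bsize e)),
       kappa (De e) (Dst e) v0 = kE e) /\
    (forall e : block g, kE e = a e ^+ (bsize e - 1) * \det (Dst e)) /\
    kG = \prod_(e : block g) kE e /\
    \det D =
      \sum_(e : block g) \det (De e) * \prod_(f : block g | f != e) kE f /\
    cof D =
      \prod_(e : block g) kE e +
      \sum_(e : block g)
        (cof (De e) - kE e) * \prod_(f : block g | f != e) kE f /\
    cof D = cof M * \prod_(e : block g) a e ^+ (bsize e - 1) /\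
    cof D * \det M = kG * cof M.
Proof.
move=> M D De.
have M_block (e : block g) i j :
    (forall f : block g, (1 < #|bverts f :&: bverts e|)%N -> f = e) ->
    M (enum_val i) (enum_val j) = Dst e i j.
  by move=> e_uniq; rewrite mxE (glue_block _ _ _ (c := 1)).
have D_block (e : block g) i j :
    (forall f : block g, (1 < #|bverts f :&: bverts e|)%N -> f = e) ->
    D (enum_val i) (enum_val j) = De e i j.
  move=> e_uniq; rewrite mxE (glue_block _ _ _ (c := 0)) // => f k.
  by rewrite !mxE Dst_diag subrr mulr0.
have fuel i j : (#|[set v | separates g v i j]| <= n)%N.
  by rewrite -[X in (_ <= X)%N]card_ord max_card.
have M_sep v i j : separates g v i j -> M i j = M i v * M v j.
  move=> sv; rewrite !mxE; apply: (glue_separates g_strong) => //.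
  by move=> *; rewrite mulrA.
have D_sep v i j : separates g v i j -> D i j = D i v + M i v * D v j.
  move=> sv; rewrite ![D _ _]mxE; apply: (glue_separates g_strong) => //.
  by move=> {sv} x u w p q r /M_sep ->; ring.
pose kE e := a e ^+ (bsize e - 1) * \det (Dst e).
have mxK (A : 'M[R]_n) : \matrix_(i, j) A i j = A.
  by apply/matrixP => i j; rewrite mxE.
have dW := det_whole n_gt0 g_strong Dst_diag M_block D_block M_sep D_sep.
have cW := cof_whole n_gt0 g_strong Dst_diag M_block D_block M_sep D_sep.
have kW := kappa_on_whole n_gt0 g_strong Dst_diag M_block D_block M_sep D_sep.
rewrite !mxK in dW cW.
(* [M - J] is the additive-multiplicative distance matrix of the datum (1, Dst). *)
pose M1 i j := M i j - 1.
have M1_block (e : block g) i j :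
    (forall f : block g, (1 < #|bverts f :&: bverts e|)%N -> f = e) ->
    M1 (enum_val i) (enum_val j) = block_add_dist (fun=> 1) Dst e i j.
  by move=> e_uniq; rewrite /M1 M_block // !mxE mul1r.
have M1_sep v i j : separates g v i j -> M1 i j = M1 i v + M i v * M1 v j.
  by move=> /M_sep; rewrite /M1 => ->; ring.
(* At y = 1 the matrix (M - J) + yJ is M, on the whole graph and on each block. With all
   coefficients 1 the kappa of a block is [\det (Dst e)], so every summand vanishes and only the
   product remains. *)
have detM : \det M = \prod_e \det (Dst e).
  have := pminor_add_whole n_gt0 g_strong Dst_diag M_block M1_block M_sep M1_sep 1.
  rewrite [X in _ + X]big1 => [|e _]; last first.
    by rewrite /block_add_dist /= expr1n scale1r subrK !mul1r subrr mul0r.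
  rewrite addr0 mul1r (eq_bigr (fun e => \det (Dst e))) => [<-|e _]; last first.
    by rewrite expr1n mul1r.
  by congr (\det _); apply/matrixP => i j; rewrite [RHS]mxE !inE /= /M1 subrK.
have cofM : cof M = \prod_e \det (Dst e) +
    \sum_e (cof (Dst e) - \det (Dst e)) * \prod_(f | f != e) \det (Dst f).
  have := cof_whole n_gt0 g_strong Dst_diag M_block M1_block M_sep M1_sep.
  have -> : \matrix_(i, j) M1 i j = M - const_mx 1.
    by apply/matrixP => i j; rewrite [LHS]mxE [RHS]mxE; congr (_ + _); rewrite !mxE.
  rewrite cof_subJ => ->; congr (_ + _).
    by apply: eq_bigr => e _; rewrite expr1n mul1r.
  apply: eq_bigr => e _; rewrite /block_add_dist /= scale1r cof_subJ expr1n mul1r.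
  by congr (_ * _); apply: eq_bigr => f _; rewrite expr1n mul1r.
pose pa := \prod_e a e ^+ (bsize e - 1).
have kEprod : \prod_e kE e = \det M * pa.
  by rewrite detM /kE big_split mulrC.
(* Both [cof (De e)] and [kE e] carry the factor [a e ^+ (bsize e - 1)], so each summand for D is
   the one for M times the full product [pa]. *)
have cofD : cof D = cof M * pa.
  rewrite cW cofM mulrDl -[X in X * pa]detM -kEprod; congr (_ + _).
  rewrite mulr_suml; apply: eq_bigr => e _.
  rewrite /De /block_add_dist cofZ cof_subJ /kE big_split /=.
  by rewrite [pa](bigD1 e) //=; ring.
exists (\prod_e kE e), kE; split; [|do 7?split] => //.
- move=> v0; rewrite -(kW v0); apply: (kappa_mxsub (f := id)) => // x.
  by rewrite inE; apply/esym/codomP; exists x.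
- by move=> e v0; rewrite kappa_one_block.
- by rewrite cofD kEprod; ring.
Qed.
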